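(* There is a function $\varepsilon$ defined on the even integers $n \ge 4$ with $\varepsilon(n)\to 0$ as $n\to\infty$ such that for every even integer $n\geq 4$, \[\left(\frac{\sqrt{2}}{2}+\varepsilon(n)\right)\sqrt{n}\ \leq\ r_{\mathrm{odd}}(n,C_n)\ \leq\ \frac{3\sqrt{2}}{2}\sqrt{n}.\]
   Context: Graphs are finite and simple. For graphs $G,H$, the odd-Ramsey number $r_{\mathrm{odd}}(G,H)$ is the minimum positive integer $r$ for which there is an edge-colouring of $G$ with $r$ colours (not required to be proper) such that every copy of $H$ in $G$ (subgraph of $G$ isomorphic to $H$) contains an odd number of edges of at least one colour. Write $r_{\mathrm{odd}}(n,H)=r_{\mathrm{odd}}(K_n,H)$. $C_n$ denotes the cycle on $n$ vertices, so copies of $C_n$ in $K_n$ are Hamilton cycles. *)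

(* Defs.v *)
From HB Require Import structures.
From mathcomp Require Import all_boot all_order all_algebra.
From mathcomp Require Import boolp.

Set Implicit Arguments.
Unset Strict Implicit.
Unset Printing Implicit Defensive.

Local Open Scope nat_scope.

Record sgraph := SGraph {
  vertex :> finType;
  adj : rel vertex;
  adj_sym : symmetric adj;
  adj_irrefl : irreflexive adj
}.

Definition edges (G : sgraph) : {set {set G}} :=
  [set [set p.1; p.2] | p : G * G & adj p.1 p.2].

Section Complete.
Variable n : nat.

Lemma complete_sym : symmetric (fun i j : 'I_n => i != j).
Proof. by move=> i j; rewrite eq_sym. Qed.

Lemma complete_irrefl : irreflexive (fun i j : 'I_n => i != j).
Proof. by move=> i; rewrite eqxx. Qed.

Definition complete_graph : sgraph := SGraph complete_sym complete_irrefl.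

End Complete.

Section Cycle.
Variable n : nat.

(* [ordS] is the successor modulo [n]; the conjunct [i != j] only matters for  *)
(* [n = 1], where it removes a loop.                                           *)
Definition cycle_adj : rel 'I_n :=
  fun i j => (i != j) && ((j == ordS i) || (i == ordS j)).

Lemma cycle_sym : symmetric cycle_adj.
Proof. by move=> i j; rewrite /cycle_adj eq_sym orbC. Qed.

Lemma cycle_irrefl : irreflexive cycle_adj.
Proof. by move=> i; rewrite /cycle_adj eqxx. Qed.

Definition cycle_graph : sgraph := SGraph cycle_sym cycle_irrefl.

End Cycle.

(* A candidate subgraph is a pair (vertex set, edge set). *)
Definition is_subgraph (G : sgraph) (S : {set G} * {set {set G}}) : bool :=
  (S.2 \subset edges G) && [forall e in S.2, e \subset S.1].

Definition is_iso_to (H G : sgraph) (S : {set G} * {set {set G}}) : bool :=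
  [exists f : {ffun H -> G},
     [&& injectiveb f, f @: [set: H] == S.1 &
         [forall x, forall y, adj x y == ([set f x; f y] \in S.2)]]].

Definition is_copy (H G : sgraph) (S : {set G} * {set {set G}}) : bool :=
  is_subgraph S && is_iso_to H S.

(* A colouring is a function on all sets of vertices, of which only the values *)
(* on [edges G] are ever used.                                                 *)
Definition odd_coloring (G H : sgraph) (r : nat)
    (c : {ffun {set G} -> 'I_r}) : bool :=
  [forall S : {set G} * {set {set G}}, is_copy H S ==>
     [exists i : 'I_r, odd #|[set e in S.2 | c e == i]|]].

Definition odd_colorable (G H : sgraph) (r : nat) : bool :=
  (0 < r) && [exists c : {ffun {set G} -> 'I_r}, odd_coloring H c].

(* The value 0 is a junk value for when no colouring exists, which requires    *)
(* [H] to be edgeless; see [odd_colorable_ex] and [odd_ramseyP].               *)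
Definition odd_ramsey (G H : sgraph) : nat :=
  if pselect (exists r, odd_colorable G H r) is left ex then ex_minn ex else 0.

Lemma odd_colorable_ex (G H : sgraph) :
  (exists x y : H, adj x y) -> exists r, odd_colorable G H r.
Proof.
move=> [x [y xy]]; exists #|{set G}|; apply/andP; split.
  by apply/card_gt0P; exists set0.
apply/existsP; exists [ffun e => enum_rank e].
apply/forallP => S; apply/implyP => /andP[_ /existsP[f /and3P[_ _ /forallP fE]]].
have fxy : [set f x; f y] \in S.2 by move/forallP: (fE x) => /(_ y) /eqP <-.
apply/existsP; exists (enum_rank [set f x; f y]).
rewrite (_ : [set e in S.2 | _] = [set [set f x; f y]]) ?cards1 //.
apply/setP => e; rewrite !inE ffunE (inj_eq enum_rank_inj).
by case: eqP => [->|_]; rewrite ?fxy ?andbF.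
Qed.

Lemma odd_ramseyP (G H : sgraph) : (exists x y : H, adj x y) ->
  odd_colorable G H (odd_ramsey G H) /\
  forall r, odd_colorable G H r -> odd_ramsey G H <= r.
Proof.
move=> /(@odd_colorable_ex G) exH; rewrite /odd_ramsey.
by case: pselect => // ex; case: ex_minnP.
Qed.

(* Main.v *)
(** Lower bound.  Encode colour [k] as the unit vector [e_k] over the two-element
    field; we look for a Hamilton cycle whose edge vectors sum to [0].  Replacing
    a subpath [a b x y] by [a x b y] changes the sum by
    [w = ab + xy + ax + by].  Starting from a largest family of disjoint
    quadruples with linearly independent [w], an exchange argument discards
    quadruples one at a time, deleting O(r) vertices altogether, until the span
    [W] of the remaining ones contains the sum of every 4-cycle in [F] together
    with any one remaining quadruple, [F] being the set of untouched vertices.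
    Then [c xy = f x + f y + kappa] modulo [W] on such edges for a potential [f].
    A deleted vertex [v] is inserted between two vertices of [F] sending the same
    pair of colours to [v] and to a base point, which exist once
    [#|F| > r ^ 2].  As [n] is even, the resulting Hamilton cycle has its sum in
    [W], and swapping inside suitable quadruples makes it [0].  This shows
    [n < r ^ 2 + O(r)].

    Upper bound.  Fix a vertex [v] and give the other vertices distinct pairs
    (group, label) with [m = 2 ^ d] labels forming an elementary abelian 2-group.
    Colour [xy] by [label x + label y] and [vx] by the group of [x].  If all colour
    classes of a Hamilton cycle were even, the two neighbours of [v] would have
    the same group and, summing labels, the same label. *)

Require Import Defs.
From mathcomp Require Import all_boot all_order all_algebra.
From mathcomp Require Import boolp zify.
Import GRing.Theory.

Set Implicit Arguments.
Unset Strict Implicit.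
Unset Printing Implicit Defensive.

Local Open Scope ring_scope.

(** * Families of disjoint switchable paths *)

Section Gadgets.
Variables (V : finType) (r : nat) (c : V -> V -> 'rV[bool]_r).

Definition gadget : Type := V * V * V * V.

Definition gverts (q : gadget) : seq V := let: (a, b, x, y) := q in [:: a; b; x; y].

(* The change of the colour sum when the path [a b x y] becomes [a x b y]. *)
Definition gweight (q : gadget) : 'rV[bool]_r :=
  let: (a, b, x, y) := q in c a b + c x y + c a x + c b y.

Definition fverts (A : seq gadget) : seq V := flatten (map gverts A).

Definition fspan (A : seq gadget) : {vspace 'rV[bool]_r} := <<map gweight A>>%VS.

Lemma fspan_cons q A : fspan (q :: A) = (<[gweight q]> + fspan A)%VS.
Proof. by rewrite /fspan /= span_cons. Qed.

Lemma perm_fspan A B : perm_eq A B -> fspan A = fspan B.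
Proof.
move=> AB; apply: eq_span => x.
by apply: perm_mem; apply: perm_map.
Qed.

Lemma perm_fverts A B : perm_eq A B -> perm_eq (fverts A) (fverts B).
Proof. by move=> AB; apply: perm_flatten; apply: perm_map. Qed.

Definition avoids (D : {set V}) (s : seq V) := all (fun x => x \notin D) s.

(** Maximality concerns spans and not inclusion of families: [B] may consist of entirely different
    gadgets, which is what the exchange argument exploits. *)
Definition maximal_family (A : seq gadget) (D : {set V}) :=
  forall B, uniq (fverts B) -> avoids D (fverts B) ->
    (fspan A <= fspan B)%VS -> fspan B = fspan A.

Lemma free_subfamily B : exists A,
  [/\ subseq (fverts A) (fverts B), free (map gweight A) & fspan A = fspan B].
Proof.
elim: B => [|q B [A [sub frA spA]]]; first by exists [::]; split=> //; exact: nil_free.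
have [qA|qA] := boolP (gweight q \in fspan A).
  exists A; split=> //.
    by apply: subseq_trans sub _; exact: suffix_subseq.
  rewrite fspan_cons spA; apply/esym/addv_idPr.
  by rewrite -memvE -spA.
exists (q :: A); split.
- by rewrite /fverts /= cat_subseq.
- by rewrite /= free_cons qA.
- by rewrite !fspan_cons spA.
Qed.

(** Take a free family of largest size. A family with a larger span would contain a larger free one,
    and free families have at most [r] members by dimension. *)
Lemma maximal_family_start : exists A,
  [/\ uniq (fverts A), maximal_family A set0 & (size A <= r)%N].
Proof.
pose P k := `[< exists A, [/\ uniq (fverts A), free (map gweight A) & size A = k] >].
have P0 : exists k, P k.
  by exists 0%N; apply/asboolP; exists [::]; split=> //; exact: nil_free.
have sizeA A : free (map gweight A) -> (size A <= r)%N.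
  rewrite /free size_map => /eqP <-.
  by rewrite (leq_trans (dimvS (subvf _))) // dimvf /dim /= mul1n.
have Pr k : P k -> (k <= r)%N by move=> /asboolP[A [_ /sizeA + <-]].
case: (ex_maxnP P0 Pr) => k /asboolP[A [uA frA sA]] kmax.
exists A; split=> //; last exact: sizeA.
move=> B uB _ AB; apply/esym/eqP; rewrite eqEdim AB /=.
have [C [sub frC <-]] := free_subfamily B.
have /kmax : P (size C) by apply/asboolP; exists C; split=> //; exact: subseq_uniq uB.
by move: frA frC; rewrite /free !size_map /fspan => /eqP -> /eqP ->; rewrite sA.
Qed.

(* If [B] spanned more than [A], then [u :: B] and hence [B] would span the same
   space as [u :: A], so that [K :: B] would contradict maximality. *)
Lemma maximal_family_step u A D K :
  uniq (fverts (u :: A)) -> avoids D (fverts (u :: A)) ->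
  uniq (fverts (K :: A)) -> avoids D (gverts K) ->
  gweight K \notin fspan (u :: A) -> maximal_family (u :: A) D ->
  maximal_family A (D :|: [set x in gverts u] :|: [set x in gverts K]).
Proof.
move=> uuA DuA uKA DK KuA maxA B uB DB AB.
have DB' x : x \in fverts B -> [/\ x \notin D, x \notin gverts u & x \notin gverts K].
  by move=> /(allP DB); rewrite !inE !negb_or => /andP[/andP[-> ->] ->].
have avoidB q : avoids D (gverts q) -> avoids D (fverts (q :: B)).
  rewrite /avoids /fverts /= all_cat => -> /=.
  by apply/allP => x /DB'[].
have uniqB q : uniq (gverts q) -> (forall x, x \in fverts B -> x \notin gverts q) ->
    uniq (fverts (q :: B)).
  move=> uq qB; rewrite /fverts /= cat_uniq uq uB andbT /=.
  by apply/hasPn => x /qB.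
have uu : uniq (gverts u) by move: uuA; rewrite cat_uniq => /andP[].
have uK : uniq (gverts K) by move: uKA; rewrite cat_uniq => /andP[].
have Du : avoids D (gverts u) by move: DuA; rewrite /avoids all_cat => /andP[].
have uBE : fspan (u :: B) = fspan (u :: A).
  apply: maxA; first by apply: uniqB => // x /DB'[].
    exact: avoidB.
  by rewrite !fspan_cons addvS.
have BuA : (fspan B <= fspan (u :: A))%VS by rewrite -uBE fspan_cons addvSr.
apply/eqP; rewrite eq_sym eqEdim AB /= leqNgt; apply/negP => dimAB.
(* [u] adds at most one dimension to [fspan A], so a strictly larger span inside [fspan (u :: A)]
   fills it. *)
have BE : fspan B = fspan (u :: A).
  apply/eqP; rewrite eqEdim BuA /= fspan_cons (leq_trans (dimv_add_leqif _ _)) //.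
  by rewrite -add1n in dimAB; rewrite (leq_trans _ dimAB) // leq_add2r dim_vline; case: (_ == _).
have KBE : fspan (K :: B) = fspan (u :: A).
  apply: maxA; first by apply: uniqB => // x /DB'[].
    exact: avoidB.
  by rewrite (fspan_cons K) BE addvSr.
case/negP: KuA; rewrite -KBE (fspan_cons K).
by rewrite (subvP (addvSl _ _)) // memv_line.
Qed.

Lemma perm_maximal_family A B D :
  perm_eq A B -> maximal_family A D -> maximal_family B D.
Proof. by move=> AB maxA C; rewrite -(perm_fspan AB); apply: maxA. Qed.

(** The last clause lets [K] reuse the vertices of one member [u]; it controls the edges between
    that gadget and the untouched vertices. *)
Definition robust_family (A : seq gadget) (D : {set V}) :=
  [/\ uniq (fverts A), avoids D (fverts A),
      forall K, uniq (fverts (K :: A)) -> avoids D (gverts K) ->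
        gweight K \in fspan A &
      forall u B K, perm_eq A (u :: B) -> uniq (fverts (K :: B)) ->
        avoids D (gverts K) -> gweight K \in fspan A].

(** While the last clause fails for some [u] and [K], drop [u] from the family and move the at most
    eight vertices of [u] and [K] into [D]. The quantity [#|D| + 8 * size A] never grows, and the
    size of the family decreases. *)
Lemma robust_family_ex : exists A D,
  robust_family A D /\ (#|D| + 8 * size A <= 8 * r)%N.
Proof.
have [A0 [uA0 maxA0 sA0]] := maximal_family_start.
have DA0 : avoids set0 (fverts A0) by apply/allP => x _; rewrite inE.
have : (#|(set0 : {set V})| + 8 * size A0 <= 8 * r)%N by rewrite cards0 leq_mul2l.
move: {2}(size A0) (erefl (size A0)) => k.
elim: k A0 set0 uA0 maxA0 DA0 {sA0} => [|k IHk] A D uA maxA DA sA cardD.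
all: have flat K : uniq (fverts (K :: A)) -> avoids D (gverts K) ->
  gweight K \in fspan A.
1,3: move=> uKA DK; have <- : fspan (K :: A) = fspan A;
  [ by apply: maxA; rewrite ?fspan_cons ?addvSr // /avoids all_cat; apply/andP
  | by rewrite fspan_cons (subvP (addvSl _ _)) // memv_line].
  exists A, D; split=> //; split=> // u B K /perm_size.
  by rewrite sA.
have [rob|] := pselect (robust_family A D); first by exists A, D.
move=> nrob.
have [[u [B [K [AuB uKB DK KA]]]]|noK] := pselect (exists u B K,
    [/\ perm_eq A (u :: B), uniq (fverts (K :: B)), avoids D (gverts K) &
        gweight K \notin fspan A]); last first.
  case: nrob; split=> // u B K AuB uKB DK; apply/negPn/negP => KA.
  by apply: noK; exists u, B, K.
have uuB : uniq (fverts (u :: B)) by rewrite -(perm_uniq (perm_fverts AuB)).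
have DuB : avoids D (fverts (u :: B)).
  by rewrite /avoids -(perm_all _ (perm_fverts AuB)).
have sB : size B = k by move/perm_size: AuB; rewrite sA /= => -[].
have uB : uniq (fverts B) by move: uuB; rewrite cat_uniq => /and3P[].
apply: (IHk B (D :|: [set x in gverts u] :|: [set x in gverts K])) => //.
- apply: maximal_family_step => //; last exact: perm_maximal_family AuB maxA.
  by rewrite -(perm_fspan AuB).
- apply/allP => x xB; rewrite !inE !negb_or.
  move: uuB uKB DuB; rewrite !cat_uniq /avoids all_cat.
  move=> /and3P[_ /hasPn uuB _] /and3P[_ /hasPn uKB _] /andP[_ /allP DB].
  by rewrite DB // uuB // uKB.
- have card4 q : (#|[set x in gverts q]| <= 4)%N.
    by rewrite cardsE (leq_trans (card_size _)) //; case: q => [[[]]].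
  have := (leq_card_setU (D :|: [set x in gverts u]) [set x in gverts K]).1.
  have := (leq_card_setU D [set x in gverts u]).1.
  move: (card4 u) (card4 K) cardD.
  rewrite sA sB; lia.
Qed.

End Gadgets.

(** * Colour sums along paths *)

Ltac row_bool :=
  let i := fresh "i" in
  apply/rowP => i; rewrite !mxE;
  repeat match goal with |- context [fun_of_matrix ?M ?a ?b] =>
    case: (fun_of_matrix M a b)
  end; by [].

Section PathSums.
Variables (V : finType) (r : nat) (c : V -> V -> 'rV[bool]_r).
Hypothesis c_sym : forall x y, c x y = c y x.

Fixpoint psum (x : V) (s : seq V) : 'rV[bool]_r :=
  if s is y :: s' then c x y + psum y s' else 0.

Lemma psum_cat x s t : psum x (s ++ t) = psum x s + psum (last x s) t.
Proof. by elim: s x => [|y s IHs] x /=; rewrite ?add0r // IHs addrA. Qed.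

Lemma row_bool_addxx (u : 'rV[bool]_r) : u + u = 0.
Proof. by apply/rowP => i; rewrite !mxE; case: (u 0 i). Qed.

(** The entry vertex [pq.1], later taken in [F], separates consecutive gadgets, because edges
    between two different gadgets are not controlled. *)
Definition gpath (pq : V * gadget V) : seq V := pq.1 :: gverts pq.2.


(** [T] is a sum of weights of some of the gadgets. Switching exactly these adds [T], and each
    switch keeps the ends of its path, so the rest of the sum is unaffected. *)
Lemma flip_gadgets (B : seq (V * gadget V)) T :
  T \in fspan c (map snd B) -> forall z, exists s,
    [/\ perm_eq s (flatten (map gpath B)), last z s = last z (flatten (map gpath B)) &
        psum z s = psum z (flatten (map gpath B)) + T].
Proof.
elim: B T => [|[p [[[a b] x] y]] B IHB] T /=.
  rewrite /fspan span_nil memv0 => /eqP -> z.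
  by exists [::]; rewrite addr0.
rewrite fspan_cons => /memv_addP[_ /vlineP[k ->]] [T' /IHB{}IHB ->] z.
have [s [ps ls es]] := IHB y.
exists ((if k then [:: p; a; x; b; y] else [:: p; a; b; x; y]) ++ s); split.
- apply: (@perm_cat _ _ [:: p; a; b; x; y]) => //.
  by case: k => //; rewrite !perm_cons perm_sym (perm_catCA [:: b] [:: x] [:: y]).
- by case: k => /=; rewrite ls.
- case: k; rewrite /= es ?scale0r ?scale1r; last by rewrite add0r !addrA.
  by rewrite (c_sym x b); row_bool.
Qed.

Variables (W : {vspace 'rV[bool]_r}) (o : V) (kappa : 'rV[bool]_r).

(** The value at [o] is chosen so that [pot x + pot o + kappa] is exactly [c x o]. *)
Definition pot x := if x == o then kappa else c x o.

(** The relation [c x y = pot x + pot y + kappa] modulo [W], summed along a path; the potentials of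
    inner vertices cancel in characteristic 2. *)
Definition neutral x s :=
  psum x s + pot x + pot (last x s) + kappa *+ size s \in W.

Lemma neutral_cat x s t :
  neutral x s -> neutral (last x s) t -> neutral x (s ++ t).
Proof.
rewrite /neutral => ns nt; rewrite psum_cat last_cat size_cat mulrnDr.
have := memvD ns nt; congr (_ \in W).
by move: (kappa *+ size s) (kappa *+ size t) => ks kt; row_bool.
Qed.

Lemma neutral1_sym x y : neutral x [:: y] -> neutral y [:: x].
Proof. by rewrite /neutral /= c_sym (addrAC _ (pot x)). Qed.

End PathSums.

Arguments gpath {V} pq.

(** * Potentials on sets whose 4-cycles sum into [W] *)

Section Flat.
Variables (V : finType) (r : nat) (c : V -> V -> 'rV[bool]_r).
Hypothesis c_sym : forall x y, c x y = c y x.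
Variables (W : {vspace 'rV[bool]_r}) (G : pred V) (o p q : V).
Hypothesis flatG : forall K, uniq (gverts K) -> all G (gverts K) -> gweight c K \in W.
Hypotheses (oG : G o) (pG : G p) (qG : G q) (opq : uniq [:: o; p; q]).

(** The colour sum of the triangle on [o], [x], [y]. *)
Let defect x y := c x y + c x o + c y o.

Let defect_sym x y : defect x y = defect y x.
Proof. by rewrite /defect c_sym addrAC. Qed.

(** The two triangles share the edge from [o] to [y]; what remains is the 4-cycle [o x y z]. *)
Let defect_step x y z : G x -> G y -> G z -> uniq [:: o; x; y; z] ->
  defect x y + defect y z \in W.
Proof.
move=> xG yG zG uxyz.
have : gweight c (o, x, z, y) \in W.
  apply: flatG; last by rewrite /= oG xG yG zG.
  by rewrite (perm_uniq (_ : perm_eq _ [:: o; x; y; z])) // !perm_cons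
     (perm_catC [:: z] [:: y]).
congr (_ \in W); rewrite /= /defect (c_sym o x) (c_sym z y) (c_sym o z).
by row_bool.
Qed.

(** Pass from [x y] through [y p] to [p q], changing one vertex at a time; the cases treat
    coincidences among these vertices. *)
Let defect_const x y : G x -> G y -> uniq [:: o; x; y] ->
  defect x y + defect p q \in W.
Proof.
have add2 u v w : u + v \in W -> v + w \in W -> u + w \in W.
  move=> uv vw; have := memvD uv vw; congr (_ \in W).
  by rewrite -addrA (addrA v) row_bool_addxx add0r.
have to_p z : G z -> uniq [:: o; z; p] -> defect z p + defect p q \in W.
  move=> zG ozp; have [->|zq] := eqVneq z q.
    by rewrite defect_sym row_bool_addxx mem0v.
  apply: defect_step => //; move: ozp opq; rewrite /= !inE !negb_or zq.
  by move=> /and3P[/andP[-> ->] -> _] /and3P[/andP[_ ->] -> _].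
move=> xG yG oxy; have [yp|yp] := eqVneq y p.
  by subst y; apply: to_p.
have oxy' : uniq [:: o; y; x].
  by rewrite (perm_uniq (_ : perm_eq _ [:: o; x; y])) // perm_cons (perm_catC [:: y] [:: x]).
have [xp|xp] := eqVneq x p.
  by subst x; rewrite defect_sym; apply: to_p.
move: oxy opq; rewrite /= !inE !negb_or => /and3P[/andP[ox oy] xy _] /and3P[/andP[op _] _ _].
apply: (add2 _ (defect y p)); last by apply: to_p => //; rewrite /= !inE negb_or oy op yp.
by apply: defect_step => //; rewrite /= !inE !negb_or ox oy op xy xp yp.
Qed.

Lemma flat_edge x y : G x -> G y -> x != y ->
  neutral c W o (c p q + c p o + c q o) x [:: y].
Proof.
move=> xG yG xy; rewrite /neutral /pot /= addr0 mulr1n -/(defect p q).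
have aux u v : u + v + u + v = 0 :> 'rV[bool]_r.
  by rewrite -addrA row_bool_addxx.
have [xo|xo] := eqVneq x o.
  subst x; rewrite eq_sym (negPf xy) (c_sym y o).
  by rewrite aux mem0v.
have [yo|yo] := eqVneq y o.
  by subst y; rewrite row_bool_addxx add0r row_bool_addxx mem0v.
by apply: defect_const => //; rewrite /= !inE negb_or !(eq_sym o) xo yo xy.
Qed.

End Flat.

(** * Building neutral paths and inserting the deleted vertices *)

Section Absorb.
Variables (V : finType) (r : nat) (col : V -> V -> 'I_r).
Hypothesis col_sym : forall x y, col x y = col y x.

Definition cvec x y : 'rV[bool]_r := delta_mx 0 (col x y).

Lemma cvec_sym x y : cvec x y = cvec y x.
Proof. by rewrite /cvec col_sym. Qed.

Variables (W : {vspace 'rV[bool]_r}) (F : {set V}) (o : V) (kappa : 'rV[bool]_r).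

Local Notation neutralW := (neutral cvec W o kappa).

(** The invariant carried by the last vertex of a path: the path may continue to any other vertex of
    [F]. *)
Definition joins x := forall p, p \in F -> p != x -> neutralW x [:: p].

Hypothesis joinsF : forall x, x \in F -> joins x.

Lemma neutral_nil x : neutralW x [::].
Proof. by rewrite /neutral /= add0r mulr0n addr0 row_bool_addxx mem0v. Qed.

Lemma neutral_rest s x : uniq (x :: s) -> {subset s <= F} -> joins x ->
  neutralW x s /\ joins (last x s).
Proof.
elim: s x => [|y s IHs] x; first by split=> //; exact: neutral_nil.
rewrite cons_uniq => /andP[xs uys] sF jx.
have yF : y \in F by apply: sF; rewrite mem_head.
have [ns js] : neutralW y s /\ joins (last y s).
  by apply: IHs => // [z zs|]; [apply: sF; rewrite inE zs orbT | exact: joinsF].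
split=> //; rewrite -cat1s; apply: neutral_cat => //; apply: jx => //.
by move: xs; rewrite inE negb_or eq_sym => /andP[].
Qed.

Lemma neutral_gadgets (B : seq (V * gadget V)) x :
  uniq (x :: flatten (map gpath B)) -> {subset map fst B <= F} ->
  (forall q, q \in map snd B -> forall y z, y \in gverts q -> z \in gverts q ->
     y != z -> neutralW y [:: z]) ->
  (forall q, q \in map snd B -> forall y, y \in gverts q -> joins y) ->
  joins x ->
  neutralW x (flatten (map gpath B)) /\ joins (last x (flatten (map gpath B))).
Proof.
elim: B x => [|[p q] B IHB] x; first by split=> //; exact: neutral_nil.
move=> u BF edge join jx.
have pF : p \in F by apply: BF; rewrite mem_head.
case: q u BF edge join => [[[a b] y] z] u BF edge join.
have qB : (a, b, y, z) \in map snd ((p, (a, b, y, z)) :: B) by rewrite mem_head.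
have [nB jB] : neutralW z (flatten (map gpath B)) /\ joins (last z (flatten (map gpath B))).
  apply: IHB.
  - by move: u => /= /andP[_ /andP[_ /andP[_ /andP[_ /andP[_]]]]].
  - by move=> t tB; apply: BF; rewrite inE tB orbT.
  - by move=> t tB; apply: edge; rewrite inE tB orbT.
  - by move=> t tB; apply: join; rewrite inE tB orbT.
  - by apply: (join _ qB); rewrite !inE eqxx !orbT.
split=> //.
move: u; rewrite /= !inE !negb_or => /andP[/and4P[xp _ _ _]].
move=> /andP[/and4P[pa _ _ _]] /andP[/and4P[ab _ _ _]] /andP[/andP[by_ _]] /andP[/andP[yz _] _].
rewrite -[_ :: _]/([:: p] ++ [:: a] ++ [:: b] ++ [:: y] ++ [:: z] ++ _).
apply: neutral_cat; first by apply: jx => //; rewrite eq_sym.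
apply: neutral_cat.
  apply/(neutral1_sym cvec_sym)/(join _ qB) => //.
  by rewrite inE eqxx.
by do 3![apply: neutral_cat; first by apply: (edge _ qB); rewrite ?inE ?eqxx ?orbT].
Qed.

Lemma same_colours_pair (Av : {set V}) v : (r * r < #|Av|)%N ->
  exists x y, [/\ x \in Av, y \in Av, x != y, col x v = col y v & col x o = col y o].
Proof.
move=> lt; apply: contrapT => no.
suff : (#|Av| <= #|{: 'I_r * 'I_r}|)%N by rewrite card_prod card_ord leqNgt lt.
apply: (@leq_card_in _ _ (fun x => (col x v, col x o))) => x y xA yA [xyv xyo].
by apply/eqP/negPn/negP => xy; apply: no; exists x, y.
Qed.

(** On the path [x v y] the two edges have equal colours, [pot x = pot y], and [kappa] occurs twice,
    so everything cancels. Excluding [o] makes both potentials colours towards [o]. Each [v] uses up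
    two vertices of [Av]. *)
Lemma absorb (D : seq V) (Av : {set V}) :
  Av \subset F :\ o -> (r * r + 2 * size D <= #|Av|)%N ->
  exists s ps, [/\ perm_eq s (D ++ ps), uniq ps, {subset ps <= Av} &
    forall x, joins x -> x \notin ps -> neutralW x s /\ joins (last x s)].
Proof.
elim: D Av => [|v D IHD] Av AvF cardAv.
  by exists [::], [::]; split=> // x jx _; split=> //; exact: neutral_nil.
have [|x [y [xA yA xy xyv xyo]]] := @same_colours_pair Av v.
  by rewrite /= in cardAv; lia.
have [||s [ps [sD ups psA nps]]] := IHD (Av :\ x :\ y).
- by rewrite (subset_trans _ AvF) // (subset_trans (subsetDl _ _)) // subsetDl.
- move: cardAv; rewrite (cardsD1 x) xA (cardsD1 y (Av :\ x)) !inE yA eq_sym xy /=.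
  by lia.
have [xps yps] : x \notin ps /\ y \notin ps.
  by split; apply/negP => /psA; rewrite !inE eqxx ?andbF.
exists [:: x, v, y & s], [:: x, y & ps]; split.
- apply/permP => a; rewrite /= !count_cat /= (permP sD) count_cat.
  move: (nat_of_bool (a x)) (nat_of_bool (a v)) (nat_of_bool (a y)) (count a D) (count a ps).
  by move=> *; lia.
- by rewrite /= inE negb_or xy xps yps.
- move=> z; rewrite !inE => /or3P[/eqP->|/eqP->|/psA] //.
  by rewrite !inE => /and3P[].
move=> z jz; rewrite inE negb_or => /andP[zx _].
have [xF yF] : x \in F :\ o /\ y \in F :\ o by split; apply: (subsetP AvF).
move: xF yF; rewrite !inE => /andP[xo xF] /andP[yo yF].
have [ns js] := nps y (joinsF yF) yps.
split=> //; rewrite -[_ :: _]/([:: x] ++ [:: v; y] ++ s).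
apply: neutral_cat; first by apply: jz; rewrite // eq_sym.
apply: neutral_cat => //; rewrite /neutral /pot /= (negPf xo) (negPf yo).
rewrite (cvec_sym v) /cvec xyv xyo addr0 mulr2n !row_bool_addxx addr0.
by rewrite add0r row_bool_addxx mem0v.
Qed.

End Absorb.

(** * Assembling the Hamilton cycle *)

Lemma perm_gpaths (V : finType) (ps : seq V) (A : seq (gadget V)) :
  size ps = size A -> perm_eq (flatten (map gpath (zip ps A))) (ps ++ fverts A).
Proof.
elim: ps A => [|p ps IHps] [|q A] //= [/IHps/permP pA].
apply/permP => a; rewrite -[fverts (q :: A)]/(gverts q ++ fverts A) /= !count_cat /= pA !count_cat.
by rewrite (addnCA (count a ps)).
Qed.

(** [d], [a], [f] stand for the numbers of deleted vertices, of gadgets and of vertices of [F]. From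
    [F] one reserves [o], [p], [q] and an entry vertex per gadget. It suffices that
    [r * r + 3 * d + 5 * a + 3 <= n], and [3 * d + 5 * a <= 24 * r]. *)
Lemma pigeonhole_room (r n d a f : nat) :
  (r * r + 26 * r + 10 <= n)%N -> (d + 8 * a <= 8 * r)%N -> (f + 4 * a + d)%N = n ->
  (r * r + 2 * d <= f - 3 - a)%N.
Proof. lia. Qed.

Lemma gadgets_room (r n d a f : nat) :
  (r * r + 26 * r + 10 <= n)%N -> (d + 8 * a <= 8 * r)%N -> (f + 4 * a + d)%N = n ->
  (a <= f - 3)%N.
Proof. lia. Qed.

Lemma count_shuffle (k a b c d e : nat) :
  (k + (a + b + (c + d + e)) = k + (a + (d + e) + (b + c)))%N.
Proof. lia. Qed.

Lemma balanced_cycle (V : finType) (r : nat) (col : V -> V -> 'I_r) :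
  (forall x y, col x y = col y x) -> ~~ odd #|V| ->
  (r * r + 26 * r + 10 <= #|V|)%N ->
  exists x s, [/\ uniq (x :: s), size (x :: s) = #|V| &
    psum (cvec col) x (rcons s x) = 0].
Proof.
move=> col_sym evenV cardV.
have V_gt1 : (1 < #|V|)%N by lia.
have c_sym := cvec_sym col_sym.
have [A [D [[uA DA flatA exchA] cardDA]]] := robust_family_ex (cvec col).
set W := fspan _ A in flatA exchA.
pose F := [set x | (x \notin D) && (x \notin fverts A)].
have FE x : (x \in F) = (x \notin D) && (x \notin fverts A) by rewrite inE.
have size_fverts (B : seq (gadget V)) : size (fverts B) = (4 * size B)%N.
  elim: B => [|[[[? ?] ?] ?] B IHB] //=; move: IHB; rewrite /fverts => ->; lia.
have permV : perm_eq (enum F ++ fverts A ++ enum D) (enum V).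
  apply: uniq_perm; rewrite ?enum_uniq //.
    rewrite !cat_uniq !enum_uniq uA !andbT /=; apply/andP; split.
      apply/hasPn => x; rewrite mem_cat !mem_enum FE => /orP[-> | ->] //=.
      by rewrite andbF.
    by apply/hasPn => x; rewrite mem_enum; apply: contraL => /(allP DA).
  move=> x; rewrite !mem_cat !mem_enum FE inE /=.
  by case: (x \in D); case: (x \in fverts A).
have cardF : (#|F| + 4 * size A + #|D| = #|V|)%N.
  by move/perm_size: permV; rewrite !size_cat size_fverts -!cardE addnA.
have uF := enum_uniq (mem F).
have memF x : (x \in enum F) = (x \in F) by rewrite mem_enum.
have sizeF : size (enum F) = #|F| by rewrite -cardE.
case: (enum F) uF memF sizeF permV => [|o [|p [|q t]]] uF memF sizeF permV.
1-3: by move: sizeF => /=; lia.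
have [oF pF qF] : [/\ o \in F, p \in F & q \in F].
  by split; rewrite -memF !inE eqxx ?orbT.
have uopq : uniq [:: o; p; q].
  by apply: subseq_uniq uF; rewrite /= !eqxx; case: t {memF sizeF permV}.
(* As [o], [p], [q] lie in [F], the same [kappa] serves [F] alone and [F] enlarged by any one
   gadget. *)
pose kappa := cvec col p q + cvec col p o + cvec col q o.
have flatF K : uniq (gverts K) -> all (mem F) (gverts K) -> gweight (cvec col) K \in W.
  move=> uK /allP KF; apply: flatA; last first.
    by apply/allP => x /KF; rewrite /= FE => /andP[].
  rewrite /fverts /= cat_uniq uK uA andbT; apply/hasPn => x; apply: contraL => /KF.
  by rewrite /= FE => /andP[].
(* Here the exchange clause of robustness enters, with [u] taken out of the family. *)
have flatFu u : u \in A -> forall K, uniq (gverts K) ->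
    all (fun x => (x \in F) || (x \in gverts u)) (gverts K) -> gweight (cvec col) K \in W.
  move=> uinA K uK /allP KF.
  have AE := perm_to_rem uinA; have vAE := perm_fverts AE.
  have := uA; rewrite (perm_uniq vAE) cat_uniq => /and3P[uu /hasPn ruN ur].
  apply: (exchA _ _ _ AE).
    rewrite /fverts /= cat_uniq uK ur andbT; apply/hasPn => x xr; apply/negP => /KF.
    rewrite FE (perm_mem vAE) mem_cat xr orbT andbF /=.
    by apply/negP; apply: ruN.
  apply/allP => x /KF; rewrite FE => /orP[/andP[] // | xu].
  by apply: (allP DA); rewrite (perm_mem vAE) mem_cat xu.
have joinsF x : x \in F -> joins col W F o kappa x.
  by move=> xF y yF; rewrite eq_sym; apply: (flat_edge c_sym flatF).
have edgeA u : u \in A -> forall y z, y \in gverts u -> z \in gverts u -> y != z ->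
    neutral (cvec col) W o kappa y [:: z].
  move=> uinA y z yu zu; apply: (flat_edge c_sym (flatFu u uinA));
  by rewrite ?oF ?pF ?qF ?yu ?zu ?orbT.
have joinsA u : u \in A -> forall y, y \in gverts u -> joins col W F o kappa y.
  move=> uinA y yu z zF; rewrite eq_sym; apply: (flat_edge c_sym (flatFu u uinA));
  by rewrite ?oF ?pF ?qF ?yu ?zF ?orbT.
pose ps := take (size A) t.
have sizet : size t = (#|F| - 3)%N by rewrite -sizeF /= !subSS subn0.
have sps : size ps = size A 
  by apply: size_takel; rewrite sizet; exact: gadgets_room cardV cardDA cardF.
pose B := zip ps A.
have B2 : map snd B = A by rewrite -/unzip2 unzip2_zip // sps.
have B1 : map fst B = ps by rewrite -/unzip1 unzip1_zip // sps.
have permB : perm_eq (flatten (map gpath B)) (ps ++ fverts A) := perm_gpaths sps.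
pose Av := [set x in drop (size A) t].
have ut : uniq t by move: uF => /and4P[].
have tF x : x \in t -> x \in F by move=> xt; rewrite -memF !inE xt !orbT.
have ot : o \notin t by move: uF => /andP[+ _]; rewrite !inE !negb_or => /and3P[].
have psP x : x \in ps -> [/\ x \in F, x != o & x \notin Av].
  move=> xps; have xt : x \in t := mem_take xps.
  split; [exact: tF | by apply: contraTneq xt => -> |].
  rewrite inE; apply/negP => xd.
  move: ut; rewrite -(cat_take_drop (size A) t) cat_uniq => /and3P[_ /hasPn /(_ _ xd)].
  by rewrite /= xps.
have AvF : Av \subset F :\ o.
  apply/subsetP => x; rewrite !inE => /mem_drop xt.
  by have := tF x xt; rewrite inE => ->; rewrite andbT; apply: contraTneq xt => ->.
have cardAv : (r * r + 2 * size (enum D) <= #|Av|)%N.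
  rewrite -cardE cardsE (card_uniqP _) ?drop_uniq // size_drop sizet.
  exact: pigeonhole_room cardV cardDA cardF.
have [sD [pD [permD upD pDAv absD]]] := absorb col_sym joinsF AvF cardAv.
have pDP x : x \in pD -> [/\ x \in F, x != o & x \notin ps].
  move=> /pDAv xAv; have /(subsetP AvF) := xAv; rewrite in_setD1 => /andP[-> ->].
  by split=> //; apply/negP => /psP[_ _]; rewrite xAv.
pose rest := [seq x <- o :: p :: q :: t | x \notin o :: ps ++ pD].
have permF : perm_eq (o :: ps ++ pD ++ rest) (o :: p :: q :: t).
  apply: uniq_perm => //.
    rewrite -cat_cons catA cat_uniq (filter_uniq _ uF) andbT; apply/andP; split.
      rewrite /= mem_cat negb_or cat_uniq upD andbT.
      apply/and3P; split.
      - by apply/andP; split; [apply/negP => /psP[] | apply/negP => /pDP[]]; rewrite eqxx.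
      - exact: take_uniq.
      - by apply/hasPn => x /pDP[].
    by apply/hasPn => x; rewrite mem_filter => /andP[].
  move=> x; rewrite -cat_cons catA mem_cat mem_filter.
  case: (boolP (x \in _ ++ pD)) => [|] //= xin; apply/esym; rewrite memF.
  move: xin; rewrite inE mem_cat => /or3P[/eqP-> // | /psP[] // | /pDP[] //].
(* Order along the cycle after [o]: gadgets with their entry vertices, deleted vertices between
   their chosen neighbours, the rest of [F]. *)
pose s := flatten (map gpath B) ++ sD ++ rest.
have perms : perm_eq (o :: s) (enum V).
  apply: perm_trans permV.
  apply: (@perm_trans _ ((o :: ps ++ pD ++ rest) ++ fverts A ++ enum D)).
    apply/permP => a; rewrite /= !count_cat (permP permB) (permP permD) !count_cat.
    exact: count_shuffle.
  by rewrite perm_cat2r.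
have us : uniq (o :: s) by rewrite (perm_uniq perms) enum_uniq.
have sizes : size (o :: s) = #|V| by rewrite (perm_size perms) -cardE.
have cycle_neutral : neutral (cvec col) W o kappa o (rcons s o).
  have ucat : uniq ((o :: flatten (map gpath B)) ++ sD ++ rest) by [].
  have [n1 j1] : neutral (cvec col) W o kappa o (flatten (map gpath B)) /\
      joins col W F o kappa (last o (flatten (map gpath B))).
    apply: neutral_gadgets => //; rewrite ?B1 ?B2 //.
    - by move: ucat; rewrite cat_uniq => /andP[].
    - by move=> x /psP[].
    - exact: joinsF.
  have [|n2 j2] := absD _ j1.
    apply/negP => lpD; move: ucat; rewrite cat_uniq => /and3P[_ /hasPn ucat _].
    have /ucat : last o (flatten (map gpath B)) \in sD ++ rest.
      by rewrite mem_cat (perm_mem permD) mem_cat lpD orbT.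
    by rewrite /= mem_last.
  have [||n3 j3] := neutral_rest (s := rest) joinsF _ _ j2.
  - move: ucat; rewrite catA cat_uniq => /and3P[_ /hasPn ucat urest].
    rewrite /= urest andbT; apply/negP => /ucat.
    by rewrite /= -last_cat mem_last.
  - by move=> x; rewrite mem_filter memF => /andP[].
  rewrite -cats1; apply: neutral_cat.
    by apply: neutral_cat => //; apply: neutral_cat.
  rewrite /s !last_cat; apply: j3 => //.
  rewrite -!last_cat -/s; move: us; case: (s) sizes => [|z s'] sizes.
    by move: V_gt1; rewrite -sizes.
  by rewrite /= => /andP[+ _]; apply: contraNneq => ->; rewrite mem_last.
(* The closed path counts [pot o] twice and [kappa] once per edge, an even number of times. *)
have psum_W : psum (cvec col) o (rcons s o) \in fspan (cvec col) (map snd B).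
  rewrite B2; move: cycle_neutral.
  rewrite /neutral last_rcons -addrA -/(pot _ _ _ _) size_rcons.
  rewrite -[size s]/(size (o :: s)).-1 sizes.
  rewrite prednK; last exact: ltnW.
  rewrite -(odd_double_half #|V|) (negPf evenV) add0n -muln2 mulnC mulrnA mulr2n.
  by rewrite row_bool_addxx mul0rn addr0 -addrA row_bool_addxx addr0.
(* Switching adds the sum of the whole cycle to itself, which gives 0. *)
have [s1 [ps1 ls1 es1]] := flip_gadgets c_sym psum_W o.
exists o, (s1 ++ sD ++ rest); split.
- rewrite (perm_uniq (_ : perm_eq _ (o :: s))) //.
  by rewrite perm_cons perm_cat2r.
- by rewrite -sizes; apply: perm_size; rewrite perm_cons perm_cat2r.
rewrite rcons_cat psum_cat es1 ls1 addrAC -psum_cat -rcons_cat -/s.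
exact: row_bool_addxx.
Qed.

(** * Copies of the Hamilton cycle *)

Section CycleCopies.
Variables (n : nat).
Hypothesis n_gt2 : (2 < n)%N.

Definition cyc_edges (f : 'I_n -> 'I_n) : {set {set 'I_n}} :=
  [set [set f i; f (ordS i)] | i : 'I_n].

Lemma set2_eq (T : finType) (a b x y : T) : [set a; b] = [set x; y] ->
  (a = x /\ b = y) \/ (a = y /\ b = x).
Proof.
move=> E; have := set21 a b; have := set22 a b; have := set21 x y; have := set22 x y.
rewrite {1 2}(esym E) {3 4}E !inE.
by do 4![case/orP=> /eqP ?]; subst; auto.
Qed.

Lemma ordS_neq (i : 'I_n) : ordS i != i.
Proof.
rewrite -val_eqE /=; case: (ltngtP i.+1 n) => [lt|gt|eq].
- by rewrite modn_small // gtn_eqF.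
- by have := ltn_ord i; lia.
- by rewrite eq modnn; apply/eqP; lia.
Qed.

Lemma ordS2_neq (i : 'I_n) : ordS (ordS i) != i.
Proof.
rewrite -val_eqE /=; have := ltn_ord i => lti.
case: (ltngtP i.+1 n) => [lt|gt|eq]; last 2 first.
- by lia.
- by rewrite eq modnn modn_small; [apply/eqP; lia | lia].
rewrite (modn_small lt); case: (ltngtP i.+2 n) => [lt2|gt2|eq2].
- by rewrite modn_small // gtn_eqF.
- by lia.
- by rewrite eq2 modnn; apply/eqP; lia.
Qed.

(** Two edges that agree crosswise would make an index its own second successor. Colour classes can
    thus be counted by positions. *)
Lemma cyc_edge_inj (f : 'I_n -> 'I_n) : injective f ->
  injective (fun i => [set f i; f (ordS i)]).
Proof.
move=> finj i j /set2_eq[[/finj //]|[/finj iS /finj Sj]].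
by have := ordS2_neq j; rewrite -iS Sj eqxx.
Qed.

Lemma mem_cyc_edges f x y : injective f ->
  ([set f x; f y] \in cyc_edges f) = cycle_adj x y.
Proof.
move=> finj; apply/imsetP/idP => [[i _ /set2_eq]|].
  case=> [[/finj -> /finj ->]|[/finj -> /finj ->]].
    by rewrite /cycle_adj eqxx eq_sym ordS_neq.
  by rewrite /cycle_adj eqxx ordS_neq orbT.
move=> /andP[_ /orP[/eqP->|/eqP->]]; first by exists x.
by exists y => //; rewrite setUC.
Qed.

Lemma card_cyc_edges (f : 'I_n -> 'I_n) (P : pred {set 'I_n}) : injective f ->
  #|[set e in cyc_edges f | P e]| = #|[set i | P [set f i; f (ordS i)]]|.
Proof.
move=> finj; rewrite -(card_imset _ (cyc_edge_inj finj)); apply: eq_card => e.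
apply/idP/imsetP => [|[i + ->]].
  rewrite inE => /andP[/imsetP[i _ ->] Pi].
  by exists i => //; rewrite inE.
by rewrite 2!inE => Pi; rewrite Pi andbT; apply/imsetP; exists i.
Qed.

Lemma is_copy_cyc_edges (f : 'I_n -> 'I_n) : injective f ->
  is_copy (cycle_graph n) (G := complete_graph n) ([set: 'I_n], cyc_edges f).
Proof.
move=> finj; apply/andP; split.
  apply/andP; split.
    apply/subsetP => e /imsetP[i _ ->].
    apply/imsetP; exists (f i, f (ordS i)) => //.
    by rewrite inE /= (inj_eq finj) eq_sym ordS_neq.
  by apply/forall_inP => e _; exact: subsetT.
apply/existsP; exists (finfun f); apply/and3P; split.
- by apply/injectiveP => x y; rewrite !ffunE => /finj.
- rewrite eqEcard subsetT /= card_imset ?leqnn //.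
  by move=> x y; rewrite !ffunE => /finj.
- apply/forallP => x; apply/forallP => y.
  by rewrite !ffunE mem_cyc_edges.
Qed.

Lemma is_copy_cycleE (S : {set 'I_n} * {set {set 'I_n}}) :
  is_copy (cycle_graph n) (G := complete_graph n) S ->
  exists2 f : 'I_n -> 'I_n, injective f & S.2 = cyc_edges f.
Proof.
move=> /andP[/andP[SE /forall_inP SV] /existsP[f /and3P[/injectiveP finj /eqP fS /forallP fE]]].
have fadj x y : ([set f x; f y] \in S.2) = cycle_adj x y.
  by have /forallP/(_ y)/eqP <- := fE x.
exists f => //; apply/setP => e; apply/idP/idP.
  move=> eS; have /imsetP[[a b] _ /= eE] := subsetP SE _ eS.
  have /subsetP eV := SV _ eS.
  have /imsetP[x _ ax] : a \in f @: [set: 'I_n] by rewrite fS eV // eE set21.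
  have /imsetP[y _ by_] : b \in f @: [set: 'I_n] by rewrite fS eV // eE set22.
  by move: eS; rewrite eE ax by_ fadj mem_cyc_edges.
move=> /imsetP[i _ ->]; rewrite fadj /cycle_adj eqxx andbT eq_sym.
exact: ordS_neq.
Qed.

Lemma odd_coloring_cycleP r (c : {ffun {set 'I_n} -> 'I_r}) :
  reflect (forall f : 'I_n -> 'I_n, injective f ->
      exists k, odd #|[set i | c [set f i; f (ordS i)] == k]|)
    (odd_coloring (G := complete_graph n) (cycle_graph n) c).
Proof.
apply: (iffP forallP) => [H f finj | H S].
  have /implyP/(_ (is_copy_cyc_edges finj))/existsP[k] := H ([set: 'I_n], cyc_edges f).
  by rewrite (card_cyc_edges (fun e => c e == k)) //; exists k.
apply/implyP => /is_copy_cycleE[f finj ->].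
have [k kP] := H f finj; apply/existsP; exists k.
by rewrite (card_cyc_edges (fun e => c e == k)).
Qed.

End CycleCopies.

(** * From vanishing sums to even colour classes *)

Lemma psum_sum (V : finType) r (c : V -> V -> 'rV[bool]_r) d x s :
  psum c x s = \sum_(i < size s) c (nth d (x :: s) i) (nth d s i).
Proof.
elim: s x => [|y s IHs] x /=; first by rewrite big_ord0.
by rewrite big_ord_recl IHs.
Qed.

Lemma natr_bool m : m%:R = odd m :> bool.
Proof. by elim: m => // m IHm; rewrite -addn1 natrD IHm oddD. Qed.

(** Coordinate [k] of the colour sum is the parity of colour class [k], so a balanced cycle
    contradicts the colouring. *)
Lemma odd_colorable_cycle_lt n r : (2 < n)%N -> ~~ odd n ->
  odd_colorable (complete_graph n) (cycle_graph n) r -> (n < r * r + 26 * r + 10)%N.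
Proof.
move=> n_gt2 evenn /andP[_ /existsP[c /(odd_coloring_cycleP n_gt2) cP]].
rewrite ltnNge; apply/negP => len.
have [||| x [s [uxs sizexs psum0]]] :=
  @balanced_cycle 'I_n r (fun a b => c [set a; b]).
- by move=> a b; rewrite setUC.
- by rewrite card_ord.
- by rewrite card_ord.
rewrite card_ord in sizexs.
pose f (i : 'I_n) := nth x (x :: s) i.
have finj : injective f.
  move=> i j /eqP; rewrite nth_uniq // ?sizexs // => /eqP.
  exact: val_inj.
have [k] := cP f finj.
have : psum (cvec (fun a b => c [set a; b])) x (rcons s x) 0 k = 0.
  by rewrite psum0 mxE.
rewrite (psum_sum _ x) size_rcons summxE -[(size s).+1]/(size (x :: s)) sizexs.
have step (i : 'I_n) : cvec (fun a b => c [set a; b])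
    (nth x (x :: rcons s x) i) (nth x (rcons s x) i) 0 k = (c [set f i; f (ordS i)] == k)%:R.
  have -> : nth x (x :: rcons s x) i = f i.
    by rewrite -rcons_cons nth_rcons sizexs ltn_ord.
  have -> : nth x (rcons s x) i = f (ordS i).
    rewrite /f nth_rcons /=; have := ltn_ord i.
    rewrite -[X in (_ < X)%N]sizexs ltnS leq_eqVlt => /orP[/eqP is_|lts].
      (* At the last index [ordS] wraps to 0, matching the final [x] that closes the cycle. *)
      by rewrite is_ ltnn eqxx -[(size s).+1]/(size (x :: s)) sizexs modnn.
    by rewrite lts modn_small // -[X in (_ < X)%N]sizexs ltnS.
  by rewrite /cvec mxE eqxx /= eq_sym.
under eq_bigr do rewrite step.
rewrite -natr_sum natr_bool.
suff -> : (\sum_(i < n) (c [set f i; f (ordS i)] == k))%N =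
    #|[set i | c [set f i; f (ordS i)] == k]| by move=> ->.
by rewrite -sum1dep_card [RHS]big_mkcond; apply: eq_bigr => i _; case: (_ == _).
Qed.

(** * The colouring for the upper bound *)

Section StarColouring.
Variables (n d : nat) (v : 'I_n).
Hypotheses (n_gt2 : (2 < n)%N) (v_last : v = n.-1 :> nat).

Let m := (2 ^ d)%N.
Let q := ((n - 2) %/ m)%N.
Let L : finZmodType := 'rV[bool]_d.
Let C : finType := (L + 'I_q)%type.

Let card_L : #|L| = m.
Proof. by rewrite card_mx card_bool mul1n. Qed.

(** [v] gets label 0, so that sums over the whole cycle may include it. *)
Definition label (x : 'I_n) : L := if x == v then 0 else nth 0 (enum L) (x %% m).

(** [v] is the last vertex, so every other [x] is at most [n - 2] and [inord] does not take its
    default value there. *)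
Definition group (x : 'I_n) : 'I_q.+1 := inord (x %/ m).

(* Group [0] shares the colour of label [0]: this saves one colour. *)
Definition star_colour (x : 'I_n) : C :=
  if unlift ord0 (group x) is Some j then inr j else inl 0.

(** On an edge at [v] the [pick] returns the other endpoint; its default concerns only the singleton
    of [v]. *)
Definition colour (e : {set 'I_n}) : C :=
  if v \in e then (if [pick x in e :\ v] is Some x then star_colour x else inl 0)
  else inl (\sum_(x in e) label x).

Lemma colour_star x : x != v -> colour [set x; v] = star_colour x.
Proof.
move=> xv; rewrite /colour set22 (_ : [set x; v] :\ v = [set x]).
  by case: pickP => [y|/(_ x)]; rewrite ?inE ?eqxx // => /eqP ->.
by apply/setP => y; rewrite !inE; rewrite orbC; case: (eqVneq y v) => [->|_ //]; rewrite eq_sym (negPf xv).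
Qed.

Lemma colour_nonstar x y : x != v -> y != v -> x != y ->
  colour [set x; y] = inl (label x + label y).
Proof.
move=> xv yv xy; rewrite /colour !inE !(eq_sym v) (negPf xv) (negPf yv) /=.
by rewrite big_setU1 ?inE // big_set1.
Qed.

Lemma label_group_inj x y : x != v -> y != v ->
  label x = label y -> group x = group y -> x = y.
Proof.
have m_gt0 : (0 < m)%N by rewrite expn_gt0.
move=> xv yv; rewrite /label (negPf xv) (negPf yv).
move/eqP; rewrite nth_uniq ?enum_uniq -?cardE ?card_L ?ltn_mod // => /eqP xym.
have grp z : z != v -> group z = (z %/ m)%N :> nat.
  move=> zv; rewrite inordK // ltnS leq_div2r //.
  move: zv; rewrite -val_eqE /= v_last; have := ltn_ord z; lia.
move/(congr1 val); rewrite /= !grp // => xyd.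
by apply: val_inj; rewrite /= (divn_eq x m) (divn_eq y m) xym xyd.
Qed.

Lemma star_colour_inj x y : star_colour x = star_colour y -> group x = group y.
Proof.
rewrite /star_colour; case: unliftP => [i|] ->; case: unliftP => [j|] -> //.
by case=> ->.
Qed.

Let value (k : C) : L := if k is inl l then l else 0.

Let value_star x : value (star_colour x) = 0.
Proof. by rewrite /star_colour; case: unlift. Qed.

Lemma colour_odd (f : 'I_n -> 'I_n) : injective f ->
  exists k, odd #|[set i | colour [set f i; f (ordS i)] == k]|.
Proof.
move=> finj; apply: contrapT => noodd.
pose e i := colour [set f i; f (ordS i)].
have even_e k : ~~ odd #|[set i | e i == k]|.
  by apply/negP => kodd; apply: noodd; exists k.
have [i0 fi0] : exists i, f i = v.
  have /codomP[i ->] : v \in codom f; last by exists i.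
  by have [g _ gK] := injF_bij finj; rewrite -(gK v) codom_f.
pose j0 := ord_pred i0.
have Sj0 : ordS j0 = i0 by exact: ord_predK.
pose x := f j0; pose y := f (ordS i0).
have fv i : (f i == v) = (i == i0) by rewrite -fi0 (inj_eq finj).
have ji0 : j0 != i0 by rewrite -Sj0 eq_sym ordS_neq.
have xv : x != v by rewrite fv.
have yv : y != v by rewrite fv ordS_neq.
have xy : x != y by rewrite (inj_eq finj) -Sj0 eq_sym ordS2_neq.
have ex : e j0 = star_colour x by rewrite /e Sj0 fi0 colour_star.
have ey : e i0 = star_colour y by rewrite /e fi0 setUC colour_star.
have nonstar i : i != i0 -> i != j0 -> e i = inl (label (f i) + label (f (ordS i))).
  move=> ii0 ij0; rewrite /e colour_nonstar ?fv //; last first.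
    by rewrite (inj_eq finj) eq_sym ordS_neq.
  by apply: contra ij0 => /eqP E; rewrite /j0 -E ordSK.
(* Only the two edges at [v] can have colour [inr j], so evenness forces both or neither. *)
have even_star j : (star_colour x == inr j) = (star_colour y == inr j).
  have := even_e (inr j); rewrite -sum1dep_card big_mkcond (bigD1 i0) //= (bigD1 j0) //=.
  rewrite big1 ?ex ?ey; first by case: (_ == _); case: (_ == _).
  by move=> i /andP[ii0 ij0]; rewrite nonstar.
have star_inl z k : star_colour z = inl k -> star_colour z = inl 0.
  by rewrite /star_colour; case: unlift => // ? [].
have exy : star_colour x = star_colour y.
  case Ex: (star_colour x) (even_star) => [k|k] exy; last first.
    by apply/esym/eqP; rewrite -exy.
  case Ey: (star_colour y) exy => [l|l] exy; last by have := exy l; rewrite eqxx.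
  by rewrite -Ex -Ey (star_inl _ _ Ex) (star_inl _ _ Ey).
(* Every colour occurs an even number of times and [L] has characteristic 2. *)
have sum_value : \sum_i value (e i) = 0.
  rewrite (partition_big e xpredT) //= big1 // => k _.
  rewrite (eq_bigr (fun=> value k)) => [|i /eqP -> //].
  rewrite sumr_const -(odd_double_half #|_|) -cardsE (negPf (even_e k)) add0n.
  by rewrite -muln2 mulnC mulrnA mulr2n row_bool_addxx mul0rn.
have sum_label : \sum_i (label (f i) + label (f (ordS i))) = 0.
  have Sinj : injective (@ordS n) by apply: (can_inj (g := @ord_pred n)); exact: ordSK.
  by rewrite big_split /= [X in X + _](reindex_inj Sinj) /= row_bool_addxx.
(* The two sums differ only at the edges through [v], which contribute [label x + label y] to one
   and 0 to the other. *)
have lxy : label x + label y = 0.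
  have lv : label v = 0 by rewrite /label eqxx.
  move: sum_value; rewrite (bigD1 i0) //= (bigD1 j0) //= ex ey !value_star !add0r.
  rewrite (eq_bigr (fun i => label (f i) + label (f (ordS i)))); last first.
    by move=> i /andP[ii0 ij0]; rewrite nonstar.
  move=> rest0; move: sum_label; rewrite (bigD1 i0) //= (bigD1 j0) //= rest0.
  by rewrite Sj0 fi0 lv add0r !addr0 addrC.
case/eqP: xy; apply: label_group_inj => //; last exact: star_colour_inj.
by apply/rowP => i; move/rowP: lxy => /(_ i); rewrite !mxE; case: (label x 0 i); case: (label y 0 i).
Qed.

End StarColouring.

(** * Integer forms of the two bounds *)

Lemma odd_colorable_cycle n d : (2 < n)%N ->
  odd_colorable (complete_graph n) (cycle_graph n) (2 ^ d + (n - 2) %/ 2 ^ d).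
Proof.
move=> n_gt2; apply/andP; split; first by rewrite addn_gt0 expn_gt0.
have vP : (n.-1 < n)%N by lia.
pose v := Ordinal vP.
have cardC : #|{: 'rV[bool]_d + 'I_((n - 2) %/ 2 ^ d)}| = (2 ^ d + (n - 2) %/ 2 ^ d)%N.
  by rewrite card_sum card_mx card_bool card_ord mul1n.
pose c := [ffun e : {set 'I_n} => cast_ord cardC (enum_rank (colour d v e))].
apply/existsP; exists c; apply/(odd_coloring_cycleP n_gt2) => f finj.
have [k kodd] := @colour_odd n d v n_gt2 erefl f finj.
exists (cast_ord cardC (enum_rank k)).
rewrite (eq_card (B := [set i | colour d v [set f i; f (ordS i)] == k])) // => i.
by rewrite !inE ffunE (inj_eq (@cast_ord_inj _ _ _)) (inj_eq enum_rank_inj).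
Qed.

Lemma cycle_graph_adj n : (2 < n)%N -> exists x y : cycle_graph n, adj x y.
Proof.
move=> n_gt2; have n_gt0 : (0 < n)%N by lia.
exists (Ordinal n_gt0), (ordS (Ordinal n_gt0)).
by rewrite /= /cycle_adj eqxx eq_sym ordS_neq.
Qed.

Lemma odd_ramsey_cycle_upper n : (2 < n)%N ->
  (2 * odd_ramsey (complete_graph n) (cycle_graph n) ^ 2 <= 9 * n)%N.
Proof.
(* With [m = 2 ^ d] this puts [m ^ 2] between [n / 2] and [2 * n]. At both ends of that range
   [m + n / m] equals the claimed bound, and it is convex in [m]. *)
move=> n_gt2; pose d := trunc_log 4 (2 * n).
have [_ /(_ _ (odd_colorable_cycle d n_gt2))] :=
  odd_ramseyP (complete_graph n) (cycle_graph_adj n_gt2).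
have := leq_trunc_div (n - 2) (2 ^ d).
have m_gt0 : (0 < 2 ^ d)%N by rewrite expn_gt0.
have m2E : (4 ^ d = (2 ^ d) ^ 2)%N by rewrite -(expnM 2 2 d) mulnC expnM.
have lb : ((2 ^ d) ^ 2 <= 2 * n)%N by rewrite -m2E trunc_logP //; lia.
have ub : (n <= 2 * (2 ^ d) ^ 2)%N.
  by have := @trunc_log_ltn 4 (2 * n) isT; rewrite expnS -/d m2E; lia.
move: (2 ^ d)%N ((n - 2) %/ 2 ^ d)%N (odd_ramsey _ _) m_gt0 lb ub => m q r m_gt0 lb ub qm rle.
rewrite -(@leq_pmul2r (m ^ 2)) ?expn_gt0 ?m_gt0 //.
have rm : (r * m <= m ^ 2 + n)%N by nia.
have : ((r * m) ^ 2 <= (m ^ 2 + n) ^ 2)%N by rewrite leq_exp2r.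
rewrite -mulnA -expnMn; move: (m ^ 2)%N lb ub => M lb ub sq.
(* [(2 M - n) (M - 2 n) <= 0], since [n / 2 <= M <= 2 n] *)
by nia.
Qed.

(** If [2 * r ^ 2 < n], then [n < r * r + 26 * r + 10] forces [r <= 26], hence [n < 1362], below the
    threshold. *)
Lemma odd_ramsey_cycle_lower n : (2000 <= n)%N -> ~~ odd n ->
  (n <= 2 * odd_ramsey (complete_graph n) (cycle_graph n) ^ 2)%N.
Proof.
move=> n_ge evenn; have n_gt2 : (2 < n)%N by lia.
have [/(odd_colorable_cycle_lt n_gt2 evenn) + _] :=
  odd_ramseyP (complete_graph n) (cycle_graph_adj n_gt2).
move: (odd_ramsey _ _) => r; nia.
Qed.

(* Passage to real square roots *)
From mathcomp Require Import all_classical all_reals all_analysis.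
From mathcomp Require Import ring lra.
Import Order.TTheory Num.Theory.
Import numFieldNormedType.Exports.
Local Open Scope classical_set_scope.

Theorem theorem1p1 (R : realType) :
  exists eps : nat -> R,
    (eps n @[n --> within [set n : nat | (4 <= n)%N /\ ~~ odd n] \oo] --> (0 : R)) /\
    (forall n : nat, (4 <= n)%N -> ~~ odd n ->
       (Num.sqrt (2 : R) / 2 + eps n) * Num.sqrt (n%:R : R)
         <= (odd_ramsey (complete_graph n) (cycle_graph n))%:R
         <= 3 * Num.sqrt (2 : R) / 2 * Num.sqrt (n%:R : R)).
Proof.
(* For small [n] this choice makes the lower bound 0; from 2000 on the error term vanishes. *)
exists (fun n => if (n < 2000)%N then - (Num.sqrt (2 : R) / 2) else 0); split.
  apply: cvg_within_filter; apply: cvg_near_cst.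
  by exists 2000%N => // n /= n_ge; rewrite ltnNge n_ge.
move=> n n_ge4 evenn; have n_gt2 : (2 < n)%N by exact: leq_trans n_ge4.
have upper := odd_ramsey_cycle_upper n_gt2.
have lower := @odd_ramsey_cycle_lower n _ evenn.
move: (odd_ramsey _ _) upper lower => rho upper lower.
have sqr2 : Num.sqrt (2 : R) ^+ 2 = 2 by rewrite sqr_sqrtr.
have sqrn : Num.sqrt (n%:R : R) ^+ 2 = n%:R by rewrite sqr_sqrtr.
have s2_ge0 : 0 <= Num.sqrt (2 : R) by exact: sqrtr_ge0.
have sn_ge0 : 0 <= Num.sqrt (n%:R : R) by exact: sqrtr_ge0.
apply/andP; split.
  case: ltnP => [_|/lower]; first by rewrite subrr mul0r.
  rewrite -(ler_nat R) natrM natrX => le_n.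
  rewrite addr0 -(@ler_pXn2r _ 2) ?nnegrE ?mulr_ge0 ?divr_ge0 //.
  rewrite !exprMn sqr2 sqrn; lra.
move: upper; rewrite -(ler_nat R) natrM natrX natrM => le_rho.
rewrite -(@ler_pXn2r _ 2) ?nnegrE ?mulr_ge0 ?divr_ge0 //.
rewrite !exprMn sqr2 sqrn; lra.
Qed.
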